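(* Let $f^{\mathrm{lgt}}:\mathcal{X}\to\mathbb{R}^K$ satisfy $\|f^{\mathrm{lgt}}(x)\|_2\le L_f$ for all $x\in\mathcal{X}$. Let $\mathcal{L}_{\mathrm{calib}}:\mathbb{R}^K\times\mathbb{R}^K\to[0,1]$ be a per-sample calibration loss that is $L_c$-Lipschitz (w.r.t. $\ell_2$) in its second argument. Let $\Gamma>0$ and $\alpha_-\le\alpha_+$ with $\alpha_+-\alpha_-\ge 2\Gamma$, and let $\mathcal{A}=\{\boldsymbol\alpha=(\alpha_0,\dots,\alpha_K):\ |\alpha_j-\alpha_0|\le\Gamma\ \forall\,1\le j\le K,\ \alpha_-\le\alpha_0\le\alpha_+\}$. Given $n$ i.i.d. validation samples $\mathcal{S}=(X_i,Y_i)_{i=1}^n\sim\mathcal{D}$, let $\boldsymbol\alpha^\star\in\arg\min_{\boldsymbol\alpha\in\mathcal{A}}\mathcal{L}_{\mathrm{calib}}(\boldsymbol\alpha,\mathcal{S})$. Then with probability at least $1-\delta$, $$\mathcal{L}_{\mathrm{calib}}(\boldsymbol\alpha^\star,\mathcal{D})\le\min_{\boldsymbol\alpha\in\mathcal{A}}\mathcal{L}_{\mathrm{calib}}(\boldsymbol\alpha,\mathcal{D})+8\sqrt{\frac{\log(2/\delta)}{n}}+E,$$ where $E=\frac{4}{\sqrt n}\sqrt{\log\big(1+4(\alpha_+-\alpha_-)\sqrt n L_fL_c\big)}$ if $\Gamma\le\frac{1}{8\sqrt n L_fL_c}$, and $E=\frac{4}{\sqrt n}\sqrt{\log\big(\frac{\alpha_+-\alpha_-}{2\Gamma}\big)+(K+1)\log\big(8\Gamma\sqrt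 nL_fL_c\big)}$ otherwise.
   Context: Multiclass setup: $X\in\mathcal{X}$, $Y\in\{1,\dots,K\}$, $(X,Y)\sim\mathcal{D}$. The classifier is $f(X)=\mathrm{softmax}(f^{\mathrm{lgt}}(X))$ with predicted label $\hat Y=\arg\max_k f(X)_k$. For a scalar $\alpha$, the temperature-scaled classifier is $f_\alpha(X)=\mathrm{softmax}(\alpha f^{\mathrm{lgt}}(X))$. In $\mathcal{L}_{\mathrm{calib}}(Y,\cdot)$ the label $Y$ is viewed as a vector in $\mathbb{R}^K$ (e.g. one-hot). Class-wise temperature scaling losses: $\mathcal{L}_{\mathrm{calib}}(\boldsymbol\alpha,\mathcal{S})=\frac1n\sum_{i=1}^n\mathcal{L}_{\mathrm{calib}}(Y_i,f_{\alpha_{\hat Y_i}}(X_i))$ and $\mathcal{L}_{\mathrm{calib}}(\boldsymbol\alpha,\mathcal{D})=\mathbb{E}_{(X,Y)\sim\mathcal{D}}[\mathcal{L}_{\mathrm{calib}}(Y,f_{\alpha_{\hat Y}}(X))]$, where $\hat Y=\hat Y(X)$ is the predicted label of the (uncalibrated) classifier $f$ and $\alpha_{\hat Y}$ is the $\hat Y$-th coordinate of $\boldsymbol\alpha$ (the coordinate $\alpha_0$ enters only through the constraint set). *)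

(* Defs.v *)
From HB Require Import structures.
From mathcomp Require Import all_boot all_order all_algebra.
From mathcomp Require Import all_classical all_reals all_analysis.
Set Implicit Arguments. Unset Strict Implicit. Unset Printing Implicit Defensive.
Import Order.TTheory GRing.Theory Num.Theory.
Local Open Scope classical_set_scope.
Local Open Scope ring_scope.

(* Labels: the K = k.+1 classes are indexed by 'I_k.+1 (0-based).  We equip
   'I_n.+1 with the discrete sigma-algebra (every set is measurable), so that
   the data space  X * 'I_n.+1  carries the product sigma-algebra. *)
HB.instance Definition _ (n : nat) := isPointed.Build 'I_n.+1 ord0.
HB.instance Definition _ (n : nat) := @isMeasurable.Build default_measure_display
  'I_n.+1 discrete_measurable discrete_measurable0
  discrete_measurableC discrete_measurableU.

Section Defs.
Variable R : realType.

Definition l2norm (m : nat) (v : 'I_m -> R) : R :=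
  Num.sqrt (\sum_(i < m) v i ^+ 2).

Definition softmax (m : nat) (z : 'I_m -> R) : 'I_m -> R :=
  fun i => expR (z i) / \sum_(j < m) expR (z j).

Definition onehot (m : nat) (y : 'I_m) : 'I_m -> R :=
  fun j => if j == y then 1 else 0.

Definition argmax_label (k : nat) (p : 'I_k.+1 -> R) : 'I_k.+1 :=
  [arg max_(j > ord0) p j]%O.

Variables (d : measure_display) (X : measurableType d) (k : nat).
Variable flgt : X -> 'I_k.+1 -> R.

Definition classifier (x : X) : 'I_k.+1 -> R := softmax (flgt x).

Definition temp_scaled (a : R) (x : X) : 'I_k.+1 -> R :=
  softmax (fun j => a * flgt x j).

Definition Yhat (x : X) : 'I_k.+1 := argmax_label (classifier x).

(* alpha = (alpha_0, ..., alpha_K) : 'I_k.+2 -> R ; alpha_0 = alpha ord0 and the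
   coordinate for class j (paper's j+1) is alpha (lift ord0 j). *)
Definition alpha_of (alpha : 'I_k.+2 -> R) (j : 'I_k.+1) : R :=
  alpha (lift ord0 j).

Variable Lcalib : ('I_k.+1 -> R) -> ('I_k.+1 -> R) -> R.

Definition cw_loss (alpha : 'I_k.+2 -> R) (z : X * 'I_k.+1) : R :=
  Lcalib (onehot z.2) (temp_scaled (alpha_of alpha (Yhat z.1)) z.1).

Definition emp_loss (n : nat) (S : 'I_n -> X * 'I_k.+1) (alpha : 'I_k.+2 -> R) : R :=
  n%:R^-1 * \sum_(i < n) cw_loss alpha (S i).

Definition pop_loss (D : probability (X * 'I_k.+1)%type R) (alpha : 'I_k.+2 -> R) : R :=
  Rintegral D setT (cw_loss alpha).

Definition constraint_set (Gamma am ap : R) : set ('I_k.+2 -> R) :=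
  [set alpha | (forall j : 'I_k.+1, `|alpha (lift ord0 j) - alpha ord0| <= Gamma)
               /\ am <= alpha ord0 <= ap].

End Defs.

Definition iid_sample (R : realType) (dO : measure_display) (Omega : measurableType dO)
  (P : probability Omega R) (dT : measure_display) (T : measurableType dT)
  (D : probability T R) (n : nat) (Z : 'I_n -> Omega -> T) : Prop :=
  (forall i, measurable_fun setT (Z i)) /\
  (forall i (A : set T), measurable A -> P (Z i @^-1` A) = D A) /\
  (forall A : 'I_n -> set T, (forall i, measurable (A i)) ->
     fine (P (\bigcap_(i in [set: 'I_n]) (Z i @^-1` A i)))
       = \prod_(i < n) fine (P (Z i @^-1` A i))).

Definition excess_term (R : realType) (K n : nat) (Gamma am ap Lf Lc : R) : R :=
  if Gamma <= 1 / (8 * Num.sqrt n%:R * Lf * Lc) then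
    4 / Num.sqrt n%:R * Num.sqrt (ln (1 + 4 * (ap - am) * Num.sqrt n%:R * Lf * Lc))
  else
    4 / Num.sqrt n%:R *
      Num.sqrt (ln ((ap - am) / (2 * Gamma)) + K.+1%:R * ln (8 * Gamma * Num.sqrt n%:R * Lf * Lc)).

(* Main.v *)
Require Import Defs.
From HB Require Import structures.
From mathcomp Require Import all_boot all_order all_algebra.
From mathcomp Require Import all_classical all_reals all_analysis.
From mathcomp Require Import measurable_realfun ring lra.
Set Implicit Arguments.
Unset Strict Implicit.
Unset Printing Implicit Defensive.
Import Order.TTheory GRing.Theory Num.Theory.
Import numFieldNormedType.Exports.
Local Open Scope classical_set_scope.
Local Open Scope ring_scope.

(* Since [a |-> softmax (a z)] is [|z|]-Lipschitz, the loss depends on the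
   class-wise temperatures [(Lf * Lc)]-Lipschitz-continuously in the sup norm.
   Cover the constraint set by [N] sup-norm balls of radius at most
   [1 / (2 sqrt n Lf Lc)]: when [Gamma] is below the mesh, a grid for [alpha_0]
   alone suffices, otherwise take a grid of step [2 Gamma] for [alpha_0] and,
   around each of its points, a product grid for the [K] class temperatures.
   Hoeffding's inequality at the [N] centers and a union bound give a deviation
   [t = sqrt (ln (2 N / delta) / (2 n))] there, so the minimizer loses at most
   [2 t + 2 / sqrt n]; the slack in the constant [8] absorbs [2 / sqrt n] and the
   rounding of the grid sizes. *)

(** * Lipschitz continuity of the temperature-scaled softmax *)

Lemma mean_value (R : realType) (f df : R -> R) (a b : R) :
  (forall x : R, is_derive x 1 f (df x)) -> a <= b ->
  exists2 c, a <= c <= b & f b - f a = df c * (b - a).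
Proof.
move=> fdf ab.
have [|c] := @MVT_segment R f df a b ab (fun x _ => fdf x).
  apply: derivable_within_continuous => x _.
  by have [] := fdf x.
by rewrite in_itv/=; exists c.
Qed.

Lemma is_derive_exp_sum (R : realType) (m : nat) (v z : 'I_m -> R) (a : R) :
  is_derive a 1 (fun x => \sum_(i < m) v i * expR (x * z i))
    (\sum_(i < m) v i * z i * expR (a * z i)).
Proof.
have -> : (fun x => \sum_(i < m) v i * expR (x * z i)) =
    \sum_(i < m) (fun x => v i * expR (x * z i)).
  by apply/funext => x; rewrite fct_sumE.
apply: is_derive_sum => i.
apply: is_derive_eq.
by rewrite /GRing.scale/=; ring.
Qed.

Lemma exp_sum_gt0 (R : realType) (m : nat) (z : 'I_m.+1 -> R) :
  0 < \sum_(j < m.+1) expR (z j).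
Proof.
rewrite big_ord_recl; apply: ltr_pwDl; first exact: expR_gt0.
by apply: sumr_ge0 => i _; exact: expR_ge0.
Qed.

Lemma softmax_ge0 (R : realType) (m : nat) (z : 'I_m.+1 -> R) i :
  0 <= softmax z i.
Proof. by rewrite divr_ge0 ?expR_ge0// ltW// exp_sum_gt0. Qed.

Lemma sum_softmax (R : realType) (m : nat) (z : 'I_m.+1 -> R) :
  \sum_(i < m.+1) softmax z i = 1.
Proof. by rewrite -mulr_suml mulfV// gt_eqF// exp_sum_gt0. Qed.

Lemma softmax_le1 (R : realType) (m : nat) (z : 'I_m.+1 -> R) i :
  softmax z i <= 1.
Proof.
rewrite -(sum_softmax z) (bigD1 i)//= lerDl.
by apply: sumr_ge0 => j _; exact: softmax_ge0.
Qed.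

(** The Gibbs average of [z] at inverse temperature [a], which is the derivative in [a] of the
    log-partition function. *)
Definition softmax_mean (R : realType) (m : nat) (z : 'I_m -> R) (a : R) : R :=
  \sum_(i < m) softmax (fun j => a * z j) i * z i.

(** By the quotient rule each weight [p_i] has derivative [p_i * (z_i - E_p z)]. Pairing with a
    fixed [v] makes the map scalar, so that the mean value theorem applies to it. *)
Lemma is_derive_softmax_dot (R : realType) (m : nat) (v z : 'I_m.+1 -> R) (a : R) :
  is_derive a 1 (fun x => \sum_i v i * softmax (fun j => x * z j) i)
    (\sum_i v i * (softmax (fun j => a * z j) i * (z i - softmax_mean z a))).
Proof.
pose S x := \sum_(j < m.+1) expR (x * z j).
have S0 x : S x != 0 by rewrite gt_eqF// exp_sum_gt0.
have dS : is_derive a 1 S (\sum_j z j * expR (a * z j)).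
  have := @is_derive_exp_sum R m.+1 (fun=> 1) z a.
  rewrite (_ : (fun x => _) = S); last first.
    by apply/funext => x; apply: eq_bigr => j _; rewrite mul1r.
  by under eq_bigr do rewrite mul1r.
have dN := @is_derive_exp_sum R m.+1 v z a.
have -> : (fun x => \sum_i v i * softmax (fun j => x * z j) i) =
   (fun x => \sum_i v i * expR (x * z i)) * (fun x => (S x)^-1).
  apply/funext => x; rewrite mulrfctE mulr_suml; apply: eq_bigr => i _.
  by rewrite /softmax mulrA.
have dV := @is_deriveV R S a _ _ (S0 a) dS.
apply: is_derive_eq.
have -> : softmax_mean z a = (\sum_j z j * expR (a * z j)) / S a.
  by rewrite mulr_suml; apply: eq_bigr => i _; rewrite /softmax -/(S a); ring.
rewrite /GRing.scale/=.
move: (\sum_(j < m.+1) z j * _) => Q.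
rewrite (mulrC _^-1) !mulr_suml -big_split/=; apply: eq_bigr => i _.
rewrite /softmax -/(S a).
move: (S0 a); set s := S a => s0.
by field.
Qed.

(* With [w] the difference of the two softmax vectors, the mean value theorem
   applied to [a |-> <w, softmax (a z)>] gives
   [|w|^2 = (a - b) * sum_i w_i p_i (z_i - E_p z)], and the variance of [z] under
   [p] is at most [|z|^2]. *)
Lemma softmax_scale_lipschitz (R : realType) (m : nat) (z : 'I_m.+1 -> R) (a b : R) :
  l2norm (fun i => softmax (fun j => a * z j) i - softmax (fun j => b * z j) i)
    <= `|a - b| * l2norm z.
Proof.
wlog ab : a b / a <= b.
  move=> H; have [/H//|/ltW ba] := leP a b.
  rewrite distrC; move: (H _ _ ba); congr (_ <= _).
  by rewrite /l2norm; congr Num.sqrt; apply: eq_bigr => i _; ring.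
rewrite /l2norm -sqrtr_sqr -sqrtrM ?sqr_ge0//.
apply: ler_wsqrtr.
pose p x := softmax (fun j => x * z j).
rewrite -/(p a) -/(p b).
pose w i := p b i - p a i.
have [c _] := @mean_value R _ _ _ _ (is_derive_softmax_dot w z) ab.
rewrite -/(p a) -/(p b) -/(p c) => E.
have {}E : \sum_i w i ^+ 2 = \sum_i w i * ((b - a) * (p c i * (z i - softmax_mean z c))).
  transitivity (\sum_i w i * p b i - \sum_i w i * p a i).
    by rewrite -sumrB; apply: eq_bigr => i _; rewrite /w; ring.
  by rewrite E mulr_suml; apply: eq_bigr => i _; ring.
(* Young's inequality [w y <= (w^2 + y^2) / 2], termwise, stands in for Cauchy-Schwarz: half of
   [|w|^2] moves back to the left. *)
have AG : \sum_i w i ^+ 2 <=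
   2^-1 * \sum_i w i ^+ 2 + 2^-1 * \sum_i ((b - a) * (p c i * (z i - softmax_mean z c))) ^+ 2.
  rewrite {1}E !mulr_sumr -big_split/=; apply: ler_sum => i _.
  by set y := (b - a) * _; have := sqr_ge0 (w i - y); nra.
(* As [p <= 1], [p^2 <= p] turns the left side into a variance, which is at most the second
   moment. *)
have V : \sum_i (p c i * (z i - softmax_mean z c)) ^+ 2 <= \sum_i z i ^+ 2.
  apply: (@le_trans _ _ (\sum_i p c i * (z i - softmax_mean z c) ^+ 2)).
    apply: ler_sum => i _; rewrite exprMn.
    have := softmax_ge0 (fun j => c * z j) i.
    have := softmax_le1 (fun j => c * z j) i; rewrite -/(p c i) => p1 p0.
    by rewrite ler_wpM2r ?sqr_ge0//; nra.
  have [M MM] : exists M, softmax_mean z c = M by eexists.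
  rewrite MM.
  have -> : \sum_i p c i * (z i - M) ^+ 2 = \sum_i p c i * z i ^+ 2 - M ^+ 2.
    transitivity (\sum_i p c i * z i ^+ 2 - 2 * M * (\sum_i p c i * z i) + M ^+ 2 * \sum_i p c i).
      by rewrite !mulr_sumr -sumrB -big_split/=; apply: eq_bigr => i _; ring.
    by rewrite sum_softmax -/(softmax_mean z c) MM; ring.
  rewrite lerBlDr; apply: ler_wpDr; rewrite ?sqr_ge0//.
  apply: ler_sum => i _; rewrite ler_piMl ?sqr_ge0//; exact: softmax_le1.
have -> : \sum_i (p a i - p b i) ^+ 2 = \sum_i w i ^+ 2.
  by apply: eq_bigr => i _; rewrite /w; ring.
have : \sum_i ((b - a) * (p c i * (z i - softmax_mean z c))) ^+ 2 <=
   (a - b) ^+ 2 * \sum_i z i ^+ 2.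
  under eq_bigr do rewrite exprMn.
  rewrite -mulr_sumr (_ : (a - b) ^+ 2 = (b - a) ^+ 2); last by ring.
  by rewrite ler_wpM2l ?sqr_ge0.
by move: AG; lra.
Qed.

(** * Hoeffding's inequality *)

(** The logarithmic gap [g] vanishes at 0 together with its derivative [h], and its second
    derivative is [1/4 - w (1 - w) >= 0], where [w] is the success probability after exponential
    tilting. Two uses of the mean value theorem give [0 <= g l]. *)
Lemma bernoulli_mgf_le (R : realType) (mu l : R) : 0 <= mu <= 1 -> 0 <= l ->
  1 - mu + mu * expR l <= expR (l * mu + l ^+ 2 / 8).
Proof.
move=> /andP[mu0 mu1] l0.
pose d x : R := 1 - mu + mu * expR x.
have d0 x : 0 < d x by rewrite /d; have := expR_gt0 x; nra.
have dd (x : R) : is_derive x 1 d (mu * expR x).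
  by apply: is_derive_eq; rewrite /GRing.scale/=; ring.
pose w x := mu * expR x / d x.
pose h x := mu + x / 4 - w x.
pose h' x := 1 / 4 - (w x - w x ^+ 2).
pose g x := x * mu + x ^+ 2 / 8 - ln (d x).
have dh (x : R) : is_derive x 1 h (h' x).
  have dx0 : d x != 0 by rewrite gt_eqF.
  have dV := @is_deriveV R d x _ _ dx0 (dd x).
  apply: is_derive_eq; rewrite /GRing.scale/= /h' /w.
  by field.
have dg (x : R) : is_derive x 1 g (h x).
  have dL := is_derive1_ln (d0 x).
  have := @is_derive1_comp R _ _ _ _ _ dL (dd x) => dC.
  apply: is_derive_eq; rewrite /GRing.scale/= /h /w.
  by field; rewrite gt_eqF.
have h0 x : 0 <= x -> 0 <= h x.
  move=> x0; have [c _] := @mean_value R _ _ _ _ dh x0.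
  have -> : h 0 = 0 by rewrite /h /w /d expR0 mulr1 subrK divr1 mul0r addr0 subrr.
  rewrite !subr0 => ->; apply: mulr_ge0 => //.
  by rewrite /h'; have := sqr_ge0 (w c - 1 / 2); nra.
have [c /andP[c0 _]] := @mean_value R _ _ _ _ dg l0.
have -> : g 0 = 0.
  by rewrite /g /d expR0 mulr1 subrK ln1; ring.
rewrite !subr0 => E; have : 0 <= g l by rewrite E mulr_ge0// h0.
rewrite /g subr_ge0 => H.
by rewrite -ler_ln ?posrE ?expR_gt0 ?d0// expRK.
Qed.

Lemma expR_chord (R : realType) (l x : R) : 0 <= x <= 1 ->
  expR (l * x) <= 1 - x + x * expR l.
Proof.
move=> x01.
have := convex_expR (@Itv01 R x (andP x01).1 (andP x01).2) l 0.
rewrite !convRE /= /unstable.onem expR0.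
by rewrite mulr0 addr0 mulr1 mulrC addrC.
Qed.

Lemma measure_fin_union_le (R : realType) (d : measure_display)
  (T : measurableType d) (P : probability T R) (I : finType) (A : I -> set T)
  (B : set T) :
  measurable B -> (forall i, measurable (A i)) -> B `<=` \bigcup_i A i ->
  fine (P B) <= \sum_i fine (P (A i)).
Proof.
move=> mB mA BA.
have := @content_sub_fsum _ _ _ P I setT B A finite_finset (fun i _ => mA i) mB BA.
rewrite (_ : [set: I] = [set` index_enum I]); last first.
  by apply/seteqP; split => i //= _; rewrite mem_index_enum.
rewrite -fsbig_seq ?index_enum_uniq// => H.
rewrite -lee_fin fineK ?fin_num_measure// (le_trans H)// -sumEFin.
by apply: lee_sum => i _; rewrite fineK ?fin_num_measure.
Qed.

Lemma Rintegral_finite_range (R : realType) (d : measure_display)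
  (T : measurableType d) (D : probability T R) (V : finType) (phi : T -> V)
  (g : V -> R) :
  (forall v, measurable (phi @^-1` [set v])) -> (forall v, 0 <= g v) ->
  Rintegral D setT (g \o phi) = \sum_v g v * fine (D (phi @^-1` [set v])).
Proof.
move=> mphi g0; rewrite /Rintegral.
have mi v : measurable_fun setT (fun z => (\1_(phi @^-1` [set v]) z)%:E : \bar R).
  by apply/measurable_EFinP; exact: measurable_indic.
rewrite (eq_integral (fun z => \sum_v ((g v)%:E * (\1_(phi @^-1` [set v]) z)%:E))%E); last first.
  move=> z _ /=; rewrite (bigD1 (phi z))//= big1 ?adde0.
    by rewrite indicE mem_set//= mule1.
  by move=> v vz; rewrite indicE memNset ?mule0//= => zv; rewrite zv eqxx in vz.
rewrite ge0_integral_sum//; last 2 first.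
- by move=> v; apply: emeasurable_funM.
- by move=> v z _; rewrite -EFinM lee_fin mulr_ge0.
rewrite -[RHS]/(fine (\sum_v g v * fine (D (phi @^-1` [set v])))%:E) -sumEFin.
congr fine; apply: eq_bigr => v _.
rewrite ge0_integralZl ?lee_fin//.
by rewrite integral_indic// setIT EFinM fineK ?fin_num_measure.
Qed.

Lemma bounded_integrable (R : realType) (d : measure_display)
  (T : measurableType d) (D : probability T R) (f : T -> R) (M : R) :
  measurable_fun setT f -> (forall x, `|f x| <= M) ->
  D.-integrable setT (EFin \o f).
Proof.
move=> mf fM; apply: measurable_bounded_integrable => //.
  by rewrite ltey_eq fin_num_measure.
exists M; split; rewrite ?num_real// => K MK x _ /=.
by rewrite (le_trans (fM x))// ltW.
Qed.

(** Independence is given as a product formula on rectangles. When the observable has finite range,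
    [B] is covered by finitely many such rectangles, one per pattern of values, so the exponential
    moment factorizes by finite sums alone, without a product measure. *)
Lemma chernoff_finite_range (R : realType) (dO : measure_display)
  (Omega : measurableType dO) (P : probability Omega R) (dT : measure_display)
  (T : measurableType dT) (D : probability T R) (n : nat) (Z : 'I_n -> Omega -> T)
  (V : finType) (phi : T -> V) (x : V -> R) (l c mu : R) (B : set Omega) :
  iid_sample P D Z -> (forall v, measurable (phi @^-1` [set v])) ->
  (forall v, 0 <= x v <= 1) -> Rintegral D setT (x \o phi) <= mu -> 0 <= l ->
  measurable B -> (forall w, B w -> c <= \sum_i x (phi (Z i w))) ->
  fine (P B) <= expR (- (l * c)) * expR (l * mu + l ^+ 2 / 8) ^+ n.
Proof.
move=> [mZ [idZ indZ]] mphi x01 xmu l0 mB Bc.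
pose q v := fine (D (phi @^-1` [set v])).
have q0 v : 0 <= q v by rewrite fine_ge0.
have qS : \sum_v q v = 1.
  have := @Rintegral_finite_range _ _ _ D V phi (fun=> 1) mphi (fun=> ler01).
  under eq_bigr do rewrite mul1r.
  move=> <-; rewrite (@Rintegral_cst _ _ _ D _ measurableT 1) mul1r.
  exact: (congr1 fine (@probability_setT _ _ _ D)).
have mgf : \sum_v q v * expR (l * x v) <= expR (l * mu + l ^+ 2 / 8).
  rewrite Rintegral_finite_range// in xmu; last by move=> v; have /andP[] := x01 v.
  set mu' := \sum_v _ in xmu.
  have mu'E : mu' = \sum_v q v * x v by apply: eq_bigr => v _; rewrite mulrC.
  have mu'01 : 0 <= mu' <= 1.
    rewrite mu'E sumr_ge0/=; last by move=> v _; rewrite mulr_ge0//; have /andP[] := x01 v.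
    rewrite -qS; apply: ler_sum => v _; rewrite ler_piMr//; by have /andP[] := x01 v.
  apply: (@le_trans _ _ (1 - mu' + mu' * expR l)).
    have -> : 1 - mu' + mu' * expR l = \sum_v q v * (1 - x v + x v * expR l).
      rewrite -{1}qS mu'E mulr_suml -sumrB -big_split/=.
      by apply: eq_bigr => v _; ring.
    by apply: ler_sum => v _; rewrite ler_wpM2l//; exact: expR_chord.
  apply: (le_trans (bernoulli_mgf_le mu'01 l0)).
  by rewrite ler_expR lerD2r ler_wpM2l.
(* Only the patterns whose sum reaches [c] contribute a cell. *)
pose A (v : {ffun 'I_n -> V}) : set Omega :=
  if c <= \sum_i x (v i) then \bigcap_(i in [set: 'I_n]) (Z i @^-1` (phi @^-1` [set (v i)]))
  else set0.
have mZphi i v : measurable (Z i @^-1` (phi @^-1` [set v])).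
  by rewrite -[X in measurable X]setTI; apply: mZ.
have mA v : measurable (A v).
  rewrite /A; case: ifP => // _; apply: fin_bigcap_measurable => // i _.
have BA : B `<=` \bigcup_v A v.
  move=> w Bw; exists [ffun i => phi (Z i w)] => //=.
  rewrite /A; under eq_bigr do rewrite ffunE.
  rewrite Bc// => i _ /=; by rewrite ffunE.
have U := @measure_fin_union_le _ _ _ P _ A B mB mA BA.
apply: (le_trans U).
(* Markov's inequality cell by cell: a cell that counts is weighted by [exp (l (sum - c)) >= 1], and
   the others get a nonnegative weight. *)
apply: (@le_trans _ _ (\sum_(v : {ffun 'I_n -> V})
    expR (- (l * c)) * \prod_i (q (v i) * expR (l * x (v i))))).
  apply: ler_sum => v _; rewrite /A; case: ifPn => [cv|_]; last first.
    rewrite measure0/= mulr_ge0 ?expR_ge0// prodr_ge0// => i _.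
    by rewrite mulr_ge0 ?expR_ge0.
  rewrite (indZ (fun i => phi @^-1` [set v i]))//.
  rewrite big_split/= -expR_sum -mulr_sumr mulrCA -expRD.
  rewrite (eq_bigr (fun i => q (v i))); last by move=> i _; rewrite idZ.
  rewrite ler_peMr ?prodr_ge0// -[leLHS]expR0 ler_expR addrC subr_ge0.
  by rewrite ler_wpM2l.
rewrite -mulr_sumr ler_wpM2l ?expR_ge0//.
(* Distributivity turns the sum over patterns into the [n]-th power of the moment generating
   function of one sample. *)
rewrite -(bigA_distr_bigA (fun i v => q v * expR (l * x v))) prodr_const card_ord.
by rewrite lerXn2r// ?nnegrE ?expR_ge0// sumr_ge0// => v _; rewrite mulr_ge0 ?expR_ge0.
Qed.

Lemma le_expR_limit (R : realType) (a b C : R) : 0 <= C ->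
  (forall m : nat, a <= expR (b + C / m.+1%:R)) -> a <= expR b.
Proof.
move=> C0 H; have [a0|a0] := leP a 0; first by rewrite (le_trans a0)// expR_ge0.
rewrite -[a]lnK ?posrE// ler_expR; apply/ler_addgt0Pl => e e0.
have := H (Num.truncn (C / e)).
rewrite -{1}[a]lnK ?posrE// ler_expR => /le_trans; apply.
rewrite addrC lerD2r ler_pdivrMr ?ltr0n// mulrC -ler_pdivrMr//.
exact/ltW/truncnS_gt.
Qed.

Lemma measurable_superlevel (R : realType) (d : measure_display)
  (T : measurableType d) (f : T -> R) (t : R) :
  measurable_fun setT f -> measurable [set x | t <= f x].
Proof.
move=> /(_ measurableT `[t, +oo[%classic (measurable_itv _)).
rewrite setTI; congr measurable; apply/seteqP; split => x /=;
  by rewrite in_itv/= andbT.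
Qed.

Lemma measurable_sample_sum (R : realType) (dO dT : measure_display)
  (Omega : measurableType dO) (T : measurableType dT) (n : nat)
  (Z : 'I_n -> Omega -> T) (f : T -> R) :
  measurable_fun setT f -> (forall i, measurable_fun setT (Z i)) ->
  measurable_fun setT (fun w => \sum_i f (Z i w)).
Proof. by move=> mf mZ; apply: measurable_sum => i; exact: measurableT_comp. Qed.

(* The sample is discretized to multiples of [1 / m.+1], which reduces the
   moment generating function of the sum to a finite product; then [m] tends to
   infinity. *)
Lemma hoeffding_upper (R : realType) (dO : measure_display)
  (Omega : measurableType dO) (P : probability Omega R) (dT : measure_display)
  (T : measurableType dT) (D : probability T R) (n : nat) (Z : 'I_n -> Omega -> T)
  (f : T -> R) (t : R) :
  iid_sample P D Z -> measurable_fun setT f -> (forall z, 0 <= f z <= 1) -> 0 <= t ->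
  fine (P [set w | n%:R * (Rintegral D setT f + t) <= \sum_i f (Z i w)])
    <= expR (- (2 * n%:R * t ^+ 2)).
Proof.
move=> iidZ mf f01 t0; have [mZ _] := iidZ.
(* The exponent [- l t + l^2 / 8] per sample is minimal at [l = 4 t], with value [- 2 t^2]. Rounding
   lowers the threshold by [n / m.+1], which costs [l n / m.+1], hence this constant. *)
apply: (@le_expR_limit _ _ _ (4 * t * n%:R)) => [|m]; first by rewrite !mulr_ge0.
(* There are [m.+2] levels because the value 1 has a level of its own. *)
pose phi z : 'I_m.+2 := inord (Num.truncn (m.+1%:R * f z)).
pose x (v : 'I_m.+2) : R := v%:R / m.+1%:R.
have m0 : 0 < m.+1%:R :> R by rewrite ltr0n.
have mf0 z : 0 <= m.+1%:R * f z by rewrite mulr_ge0//; have /andP[] := f01 z.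
have phiE z : phi z = Num.truncn (m.+1%:R * f z) :> nat.
  rewrite inordK// ltnS -(ler_nat R) (@le_trans _ _ (m.+1%:R * f z)) ?truncn_le//.
  by rewrite ler_piMr//; have /andP[] := f01 z.
have mphi v : measurable (phi @^-1` [set v]).
  rewrite (_ : _ @^-1` _ = f @^-1` `[v%:R / m.+1%:R, v.+1%:R / m.+1%:R[).
    by rewrite -[X in measurable X]setTI; apply: mf.
  apply/seteqP; split => z /=; rewrite in_itv/= ler_pdivrMr// ltr_pdivlMr// (mulrC (f z)).
    by move=> <-; rewrite phiE truncn_itv.
  by rewrite -truncn_eq// -phiE => /eqP vz; apply/val_inj.
have x01 v : 0 <= x v <= 1.
  by rewrite divr_ge0//= ler_pdivrMr// mul1r ler_nat -ltnS.
have xf z : x (phi z) <= f z <= x (phi z) + m.+1%:R^-1.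
  have /andP[h1 h2] := truncn_itv (mf0 z).
  rewrite /x phiE ler_pdivrMr// (mulrC (f z)) h1/=.
  by rewrite -[X in _ + X]mul1r -mulrDl natr1 ler_pdivlMr// (mulrC (f z)) ltW.
have mxphi : measurable_fun setT (x \o phi).
  move=> _ Y mY; rewrite setTI.
  rewrite (_ : _ @^-1` _ = \bigcup_(v in [set v | Y (x v)]) (phi @^-1` [set v])).
    by apply: fin_bigcup_measurable => // v _.
  apply/seteqP; split => z /=; first by move=> ?; exists (phi z).
  by move=> [v /= Yv ->].
have xint : Rintegral D setT (x \o phi) <= Rintegral D setT f.
  apply: le_Rintegral => //; last by move=> z _ /=; have /andP[] := xf z.
  - apply: (@bounded_integrable _ _ _ D _ 1) => // z /=.
    by have /andP[? ?] := x01 (phi z); rewrite ger0_norm.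
  - apply: (@bounded_integrable _ _ _ D _ 1) => // z /=.
    by have /andP[? ?] := f01 z; rewrite ger0_norm.
set mu := Rintegral D setT f in xint *.
set B := [set w | _].
have mB : measurable B by exact/measurable_superlevel/measurable_sample_sum.
have Bc w : B w -> n%:R * (mu + t) - n%:R / m.+1%:R <= \sum_i x (phi (Z i w)).
  rewrite /B/= => /le_trans Bw; rewrite lerBlDr; apply: Bw.
  have -> : n%:R / m.+1%:R = \sum_(i < n) (m.+1%:R^-1 : R).
    by rewrite sumr_const card_ord mulr_natl.
  by rewrite -big_split/=; apply: ler_sum => i _; have /andP[] := xf (Z i w).
have t40 : 0 <= 4 * t by rewrite mulr_ge0.
apply: (le_trans (chernoff_finite_range iidZ mphi x01 xint t40 mB Bc)).
rewrite -expRM_natl -expRD ler_expR.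
rewrite le_eqVlt; apply/orP; left; apply/eqP.
by field; rewrite gt_eqF.
Qed.

Lemma hoeffding (R : realType) (dO : measure_display)
  (Omega : measurableType dO) (P : probability Omega R) (dT : measure_display)
  (T : measurableType dT) (D : probability T R) (n : nat) (Z : 'I_n -> Omega -> T)
  (f : T -> R) (t : R) :
  iid_sample P D Z -> measurable_fun setT f -> (forall z, 0 <= f z <= 1) -> 0 <= t ->
  (0 < n)%N ->
  let B := [set w | t <= `|n%:R^-1 * \sum_i f (Z i w) - Rintegral D setT f|] in
  measurable B /\ fine (P B) <= 2 * expR (- (2 * n%:R * t ^+ 2)).
Proof.
move=> iidZ mf f01 t0 n0 B; have [mZ _] := iidZ.
have n0' : 0 < n%:R :> R by rewrite ltr0n.
have mS := @measurable_sample_sum R _ _ _ _ _ Z _ mf mZ.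
set mu := Rintegral D setT f in B *.
have mB : measurable B.
  apply: measurable_superlevel; apply: measurableT_comp => //.
  by apply: measurable_funB => //; exact: measurable_funM.
split=> //.
(* The lower tail of [f] is the upper tail of [1 - f], which also takes values in [0, 1]. *)
pose g z := 1 - f z.
have mg : measurable_fun setT g by apply: measurable_funB.
have g01 z : 0 <= g z <= 1 by have /andP[? ?] := f01 z; rewrite /g; apply/andP; split; lra.
have fi : D.-integrable setT (EFin \o f).
  apply: (@bounded_integrable _ _ _ D _ 1) => // z /=.
  by have /andP[? ?] := f01 z; rewrite ger0_norm.
have gmu : Rintegral D setT g = 1 - mu.
  rewrite /g RintegralB//; last first.
    apply: (@bounded_integrable _ _ _ D _ 1) => // z /=; by rewrite normr1.
  rewrite (@Rintegral_cst _ _ _ D _ measurableT 1) mul1r.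
  by rewrite (congr1 fine (@probability_setT _ _ _ D)).
pose A (b : bool) := if b
  then [set w | n%:R * (mu + t) <= \sum_i f (Z i w)]
  else [set w | n%:R * (Rintegral D setT g + t) <= \sum_i g (Z i w)].
have mA b : measurable (A b).
  by rewrite /A; case: b; exact/measurable_superlevel/measurable_sample_sum.
have BA : B `<=` \bigcup_b A b.
  move=> w; rewrite /B/= ler_normr => /orP[H|H].
    exists true => //=.
    by move: H; rewrite lerBrDl -ler_pdivrMl ?invr_gt0// invrK.
  exists false => //=; rewrite gmu.
  have -> : \sum_i g (Z i w) = n%:R - \sum_i f (Z i w).
    by rewrite sumrB sumr_const card_ord.
  have -> : \sum_i f (Z i w) = n%:R * (n%:R^-1 * \sum_i f (Z i w)).
    by rewrite mulVKf// gt_eqF.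
  by move: (n%:R^-1 * _) H => s; nra.
have U := @measure_fin_union_le _ _ _ P _ A B mB mA BA.
apply: (le_trans U); rewrite big_bool/= mulr2n mulrDl mul1r.
by apply: lerD; exact: hoeffding_upper.
Qed.

(** * Measurability of the loss *)

(* A Lipschitz function is the infimum of countably many cones with rational
   apexes, so no Borel structure on the function space ['I_m -> R] is needed. *)
Lemma measurable_lipschitz_comp (R : realType) (d : measure_display)
  (T : measurableType d) (m : nat) (F : ('I_m -> R) -> R) (C : R)
  (g : T -> 'I_m -> R) :
  0 <= C -> (forall p q, `|F p - F q| <= C * l2norm (fun j => p j - q j)) ->
  (forall j, measurable_fun setT (fun x => g x j)) ->
  measurable_fun setT (fun x => F (g x)).
Proof.
move=> C0 FC mg.
apply: (measurability _ (@RGenInftyO.measurableE R)) => _ [_ [c ->] <-].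
rewrite setTI.
pose G (q : {ffun 'I_m -> rat}) :=
  [set x | F (fun j => ratr (q j)) + C * l2norm (fun j => g x j - ratr (q j)) < c].
have msqrt : measurable_fun setT (@Num.sqrt R).
  by apply: continuous_measurable_fun; exact: sqrt_continuous.
have mG q : measurable (G q).
  have : measurable_fun setT
      (fun x => F (fun j => ratr (q j)) + C * l2norm (fun j => g x j - ratr (q j))).
    apply: measurable_funD => //; apply: measurable_funM => //.
    rewrite /l2norm; apply: (measurableT_comp msqrt).
    apply: measurable_sum => j; apply: measurable_funX.
    exact: measurable_funB.
  move=> /(_ measurableT `]-oo, c[%classic (measurable_itv _)).
  rewrite setTI; congr measurable; apply/seteqP; split => x /=;
    by rewrite in_itv/=.
have -> : (fun x => F (g x)) @^-1` `]-oo, c[%classic = \bigcup_q G q.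
  apply/seteqP; split => x /=; rewrite in_itv/= => H; last first.
    case: H => q _; apply: le_lt_trans; rewrite -lerBlDl.
    by apply: le_trans (FC _ _); exact: ler_norm.
  (* An apex within [e] in each coordinate raises the cone above [F (g x)] by at most
     [2 C sqrt m e]. The [+ 1] keeps the denominator positive and makes this smaller than
     [c - F (g x)]. *)
  pose e := (c - F (g x)) / (2 * C * Num.sqrt m%:R + 1).
  have e0 : 0 < e.
    rewrite divr_gt0 ?subr_gt0// ltr_wpDl// !mulr_ge0//; exact: sqrtr_ge0.
  have [q qP] : exists q : {ffun 'I_m -> rat}, forall j, `|g x j - ratr (q j)| <= e.
    have /fin_all_exists[q qP] j : exists q : rat, `|g x j - ratr q| <= e.
      have [|q] := @rat_in_itvoo R (g x j - e) (g x j + e); first by lra.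
      by rewrite in_itv/= => /andP[? ?]; exists q; rewrite ler_norml; lra.
    by exists [ffun j => q j] => j; rewrite ffunE.
  have nq : l2norm (fun j => g x j - ratr (q j)) <= Num.sqrt m%:R * e.
    rewrite /l2norm -[X in _ * X]gtr0_norm// -sqrtr_sqr -sqrtrM//.
    apply: ler_wsqrtr.
    have -> : m%:R * e ^+ 2 = \sum_(i < m) e ^+ 2.
      by rewrite sumr_const card_ord mulr_natl.
    apply: ler_sum => j _; rewrite -real_normK ?num_real//.
    by rewrite lerXn2r// ?nnegrE ?normr_ge0// ltW.
  exists q => //; rewrite /G/=.
  have Fq : F (fun j => ratr (q j)) <= F (g x) + C * (Num.sqrt m%:R * e).
    rewrite -lerBlDl; apply: (le_trans (ler_norm _)); rewrite distrC.
    by apply: (le_trans (FC _ _)); rewrite ler_wpM2l.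
  apply: (@le_lt_trans _ _ (F (g x) + 2 * C * Num.sqrt m%:R * e)).
    by have := ler_wpM2l C0 nq; lra.
  have : (2 * C * Num.sqrt m%:R + 1) * e = c - F (g x).
    by rewrite /e mulrC divfK// gt_eqF// ltr_wpDl// !mulr_ge0//; exact: sqrtr_ge0.
  by move: e0; lra.
by apply: countable_bigcupT_measurable.
Qed.

(** The selected label, ties included, is a function of the Boolean vector marking the maximizers.
    That vector takes finitely many values, so measurability reduces to that of its level sets. *)
Lemma argmax_labelE (R : realType) (k : nat) (p : 'I_k.+1 -> R) :
  argmax_label p = odflt ord0 [pick i | [ffun i => [forall j, p j <= p i]] i].
Proof.
rewrite /argmax_label /Order.arg_max /extremum; congr odflt.
by apply: eq_pick => i; rewrite /= ffunE; apply: eq_forallb => j.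
Qed.

Lemma measurable_argmax_label (R : realType) (d : measure_display)
  (T : measurableType d) (k : nat) (p : T -> 'I_k.+1 -> R) (i : 'I_k.+1) :
  (forall j, measurable_fun setT (fun x => p x j)) ->
  measurable [set x | argmax_label (p x) = i].
Proof.
move=> mp.
pose W (b : {ffun 'I_k.+1 -> bool}) := \bigcap_(a in [set: 'I_k.+1])
  [set x | [forall j, p x j <= p x a] = b a].
have mW b : measurable (W b).
  apply: fin_bigcap_measurable => // a _.
  have mall : measurable [set x | [forall j, p x j <= p x a]].
    rewrite (_ : [set x | _] = \bigcap_(j in [set: 'I_k.+1]) [set x | 0 <= p x a - p x j]).
      apply: fin_bigcap_measurable => // j _.
      exact/measurable_superlevel/measurable_funB.
    apply/seteqP; split => x /=.
      by move=> /forallP H j _ /=; rewrite subr_ge0.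
    by move=> H; apply/forallP => j; have := H j I; rewrite /= subr_ge0.
  case: (b a) => //.
  rewrite (_ : [set x | _ = false] = ~` [set x | [forall j, p x j <= p x a]]).
    exact: measurableC.
  by apply/seteqP; split => x /=; [move=> ->|move=> /negP/negbTE].
rewrite (_ : [set x | _] = \bigcup_(b in [set b : {ffun 'I_k.+1 -> bool} |
    odflt ord0 [pick a | b a] = i]) W b).
  by apply: fin_bigcup_measurable.
apply/seteqP; split => x /=.
  rewrite argmax_labelE => H; exists [ffun a => [forall j, p x j <= p x a]] => //.
  by move=> a _ /=; rewrite ffunE.
move=> [b /= <- xb]; rewrite argmax_labelE; congr odflt; apply: eq_pick => a.
by rewrite /= ffunE; exact: xb.
Qed.

Lemma measurable_softmax (R : realType) (d : measure_display)
  (T : measurableType d) (k : nat) (z : T -> 'I_k.+1 -> R) (i : 'I_k.+1) :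
  (forall j, measurable_fun setT (fun x => z x j)) ->
  measurable_fun setT (fun x => softmax (z x) i).
Proof.
move=> mz; rewrite /softmax.
have me j : measurable_fun setT (fun x => expR (z x j)) by exact: measurableT_comp.
have -> : (fun x => expR (z x i) / \sum_j expR (z x j)) =
   (fun x => expR (z x i - ln (\sum_j expR (z x j)))).
  by apply/funext => x; rewrite expRB lnK// posrE exp_sum_gt0.
apply: measurableT_comp => //; apply: measurable_funB => //.
apply: measurableT_comp => //; exact: measurable_sum.
Qed.

Lemma measurable_cw_loss (R : realType) (d : measure_display)
  (X : measurableType d) (k : nat) (flgt : X -> 'I_k.+1 -> R)
  (Lcalib : ('I_k.+1 -> R) -> ('I_k.+1 -> R) -> R) (Lc : R) (alpha : 'I_k.+2 -> R) :
  (forall j, measurable_fun setT (fun x => flgt x j)) -> 0 <= Lc ->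
  (forall y p q, `|Lcalib y p - Lcalib y q| <= Lc * l2norm (fun j => p j - q j)) ->
  measurable_fun setT (cw_loss flgt Lcalib alpha).
Proof.
move=> mf Lc0 LL _ B mB; rewrite setTI.
pose h (y j : 'I_k.+1) x := Lcalib (onehot R y) (temp_scaled flgt (alpha_of alpha j) x).
have mh y j : measurable_fun setT (h y j).
  apply: (measurable_lipschitz_comp Lc0 (LL _)) => i.
  by apply: measurable_softmax => l; exact: measurable_funM.
(* Once the true and the predicted label are fixed, the temperature is constant and the loss is a
   Lipschitz function of a measurable softmax vector. *)
pose Q (yj : 'I_k.+1 * 'I_k.+1) : set (X * 'I_k.+1) :=
  ([set x | Yhat flgt x = yj.2] `&` h yj.1 yj.2 @^-1` B) `*` [set yj.1].
rewrite (_ : _ @^-1` _ = \bigcup_(yj in [set: 'I_k.+1 * 'I_k.+1]) Q yj).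
  apply: fin_bigcup_measurable => // -[y j] _; apply: measurableX => //.
  apply: measurableI; last by rewrite -[X in measurable X]setTI; exact: mh.
  by apply: measurable_argmax_label => l; exact: measurable_softmax.
apply/seteqP; split => -[x y] /=.
  by move=> H; exists (y, Yhat flgt x).
by move=> [[y' j] _ [[/= <- H]]] /= ->.
Qed.

(** * Empirical risk minimization over a covered set *)

Lemma Rintegral_near (R : realType) (d : measure_display)
  (T : measurableType d) (D : probability T R) (f g : T -> R) (e : R) :
  measurable_fun setT f -> measurable_fun setT g ->
  (forall z, 0 <= f z <= 1) -> (forall z, 0 <= g z <= 1) ->
  (forall z, `|f z - g z| <= e) ->
  `|Rintegral D setT f - Rintegral D setT g| <= e.
Proof.
have int1 (h : T -> R) : measurable_fun setT h -> (forall z, 0 <= h z <= 1) ->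
    D.-integrable setT (EFin \o h).
  move=> mh h01; apply: (@bounded_integrable _ _ _ D _ 1) => // z.
  by have /andP[? ?] := h01 z; rewrite ger0_norm.
have half (h1 h2 : T -> R) : measurable_fun setT h1 -> measurable_fun setT h2 ->
    (forall z, 0 <= h1 z <= 1) -> (forall z, 0 <= h2 z <= 1) ->
    (forall z, `|h1 z - h2 z| <= e) ->
    Rintegral D setT h1 <= Rintegral D setT h2 + e.
  move=> mh1 mh2 h101 h201 h12.
  have ie : D.-integrable setT (EFin \o cst e).
    by apply: (@bounded_integrable _ _ _ D _ `|e|).
  have -> : e = Rintegral D setT (cst e).
    rewrite (@Rintegral_cst _ _ _ D _ measurableT e).
    by rewrite (congr1 fine (@probability_setT _ _ _ D)) mulr1.
  rewrite -RintegralD//; try exact: int1.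
  apply: le_Rintegral => //; first exact: int1.
    apply: (@bounded_integrable _ _ _ D _ (1 + `|e|)); first exact: measurable_funD.
    move=> z /=; rewrite (le_trans (ler_normD _ _))// lerD2r.
    by have /andP[? ?] := h201 z; rewrite ger0_norm.
  by move=> z _ /=; rewrite -lerBlDl (le_trans (ler_norm _)).
move=> mf mg f01 g01 fg; rewrite ler_norml.
have := half f g mf mg f01 g01 fg.
have := half g f mg mf g01 f01 (fun z => _).
by move=> /(_ (fun z => ltac:(rewrite distrC; exact: fg))); lra.
Qed.

(* The minimizer need not depend measurably on the sample: the exceptional event
   only involves the finitely many centers of the cover. *)
Lemma erm_finite_cover (R : realType) (dO : measure_display)
  (Omega : measurableType dO) (P : probability Omega R) (dT : measure_display)
  (T : measurableType dT) (D : probability T R) (n : nat) (Z : 'I_n -> Omega -> T)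
  (A : Type) (F : set A) (loss : A -> T -> R) (I : finType) (c : I -> A)
  (e t : R) (astar : Omega -> A) :
  let emp w a := n%:R^-1 * \sum_i loss a (Z i w) in
  let pop a := Rintegral D setT (loss a) in
  iid_sample P D Z -> (0 < n)%N ->
  (forall a, measurable_fun setT (loss a)) -> (forall a z, 0 <= loss a z <= 1) ->
  (forall a, F a -> exists i, forall z, `|loss a z - loss (c i) z| <= e) ->
  0 <= t ->
  (forall w, F (astar w) /\ forall a, F a -> emp w (astar w) <= emp w a) ->
  exists G : set Omega, [/\ measurable G,
    1 - #|I|%:R * (2 * expR (- (2 * n%:R * t ^+ 2))) <= fine (P G) &
    forall w, G w -> forall a, F a -> pop (astar w) <= pop a + 2 * t + 4 * e].
Proof.
move=> emp pop iidZ n0 ml l01 cov t0 opt.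
have n0' : 0 < n%:R :> R by rewrite ltr0n.
pose B i := [set w | t <= `|emp w (c i) - pop (c i)|].
have HB i := hoeffding iidZ (ml (c i)) (l01 (c i)) t0 n0.
have mB i : measurable (B i) by have [] := HB i.
have mU : measurable (\bigcup_i B i) by apply: fin_bigcup_measurable.
exists (~` \bigcup_i B i); split; first exact: measurableC.
  rewrite probability_setC// fineB ?fin_num_measure//= lerD2l lerN2.
  have := @measure_fin_union_le _ _ _ P _ B _ mU mB (fun _ h => h).
  move=> /le_trans; apply.
  by rewrite mulr_natl -sumr_const; apply: ler_sum => i _; have [] := HB i.
have emp_near w a b : (forall z, `|loss a z - loss b z| <= e) -> `|emp w a - emp w b| <= e.
  move=> ab; rewrite /emp -mulrBr -sumrB normrM gtr0_norm ?invr_gt0//.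
  rewrite ler_pdivrMl//; apply: (le_trans (ler_norm_sum _ _ _)).
  rewrite -[in leRHS](card_ord n) mulr_natl -sumr_const.
  by apply: ler_sum => i _; exact: ab.
move=> w Gw a Fa; have [Fs /(_ a Fa) sa] := opt w.
have [i ci] := cov _ Fs; have [j cj] := cov _ Fa.
have pi := @Rintegral_near _ _ _ D _ _ _ (ml _) (ml _) (l01 _) (l01 _) ci.
have pj := @Rintegral_near _ _ _ D _ _ _ (ml _) (ml _) (l01 _) (l01 _) cj.
have ei := emp_near w _ _ ci; have ej := emp_near w _ _ cj.
have small l : `|emp w (c l) - pop (c l)| < t.
  by rewrite ltNge; apply/negP => Bl; apply: Gw; exists l.
(* From [pop (astar w)] through [pop (c i)] and [emp w (c i)] to [emp w (astar w)] costs [t + 2 e].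
   Optimality leads to [emp w a], and the way back to [pop a] through [c j] costs the same. *)
have := small i; have := small j; move: pi pj ei ej sa.
rewrite -/(pop (astar w)) -/(pop a) -/(pop (c i)) -/(pop (c j)).
rewrite !ler_norml !ltr_norml.
by move=> /andP[? ?] /andP[? ?] /andP[? ?] /andP[? ?] ? /andP[? ?] /andP[? ?]; lra.
Qed.

(** * Lipschitz dependence on the temperatures, and grid covers of the constraint set *)

Lemma cw_loss_lipschitz (R : realType) (d : measure_display)
  (X : measurableType d) (k : nat) (flgt : X -> 'I_k.+1 -> R) (Lf : R)
  (Lcalib : ('I_k.+1 -> R) -> ('I_k.+1 -> R) -> R) (Lc : R)
  (a b : 'I_k.+2 -> R) (r : R) (z : X * 'I_k.+1) :
  (forall x, l2norm (flgt x) <= Lf) -> 0 <= Lc ->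
  (forall y p q, `|Lcalib y p - Lcalib y q| <= Lc * l2norm (fun j => p j - q j)) ->
  (forall j, `|alpha_of a j - alpha_of b j| <= r) ->
  `|cw_loss flgt Lcalib a z - cw_loss flgt Lcalib b z| <= Lc * (r * Lf).
Proof.
move=> fL Lc0 LL ab; apply: (le_trans (LL _ _ _)); rewrite ler_wpM2l//.
(* The predicted label is that of the unscaled classifier, so both losses read the same coordinate
   and a single temperature is compared. *)
apply: (le_trans (softmax_scale_lipschitz _ _ _)).
by rewrite ler_pM//; exact: sqrtr_ge0.
Qed.

(** Coordinate [ord0] gets the default 0: closeness is measured on the class temperatures only, and
    the centers may lie outside the constraint set. *)
Definition alpha_of_classes (R : realType) (k : nat) (v : 'I_k.+1 -> R)
  (l : 'I_k.+2) : R := if unlift ord0 l is Some j then v j else 0.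

Lemma alpha_of_classesE (R : realType) (k : nat) (v : 'I_k.+1 -> R) j :
  alpha_of (alpha_of_classes v) j = v j.
Proof. by rewrite /alpha_of /alpha_of_classes liftK. Qed.

(** Midpoint of the [i]-th interval of length [2 r] to the right of [a]. *)
Definition grid_point (R : realType) (a r : R) (i : nat) : R := a + (2 * i%:R + 1) * r.

(** The successor provides a cell for the endpoint [b] when [2 r] divides [b - a] exactly. *)
Definition grid_size (R : realType) (a b r : R) : nat :=
  (Num.truncn ((b - a) / (2 * r))).+1.

Lemma grid_cover (R : realType) (a b r x : R) : 0 < r -> a <= x <= b ->
  exists i : 'I_(grid_size a b r), `|x - grid_point a r i| <= r.
Proof.
move=> r0 /andP[ax xb].
have r20 : 0 < 2 * r by rewrite mulr_gt0.
pose y := (x - a) / (2 * r).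
have y0 : 0 <= y by rewrite divr_ge0 ?subr_ge0// ltW.
have yi : (Num.truncn y < grid_size a b r)%N.
  by rewrite ltnS le_truncn// ler_wpM2r ?lerD2r// invr_ge0 ltW.
exists (Ordinal yi); rewrite /grid_point/=.
have /andP[] := truncn_itv y0.
rewrite -natr1 {2 3}/y ler_pdivlMr// ltr_pdivrMr// => h1 h2.
by rewrite ler_norml; apply/andP; split; lra.
Qed.

Lemma grid_size_le (R : realType) (a b r : R) : 0 < r -> a <= b ->
  (grid_size a b r)%:R <= 1 + (b - a) / (2 * r).
Proof.
move=> r0 ab; rewrite /grid_size -natr1 addrC lerD2l truncn_le.
by rewrite divr_ge0 ?subr_ge0// ltW// mulr_gt0.
Qed.

Definition class_cover (R : realType) (k : nat) (F : set ('I_k.+2 -> R)) (I : finType)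
  (c : I -> 'I_k.+2 -> R) (r : R) : Prop :=
  forall alpha, F alpha ->
    exists i, forall j, `|alpha_of alpha j - alpha_of (c i) j| <= r.

Definition coarse_center (R : realType) (k : nat) (am ap r : R)
  (i : 'I_(grid_size am ap r)) : 'I_k.+2 -> R :=
  alpha_of_classes (fun=> grid_point am r i).

(** Offsets range over [[-2 Gamma, 2 Gamma]]: a class temperature is within [Gamma] of [alpha_0],
    itself within [Gamma] of its grid point. *)
Definition fine_center (R : realType) (k : nat) (Gamma am ap r : R)
  (i : 'I_(grid_size am ap Gamma) *
       {ffun 'I_k.+1 -> 'I_(grid_size (- (2 * Gamma)) (2 * Gamma) r)}) :
  'I_k.+2 -> R :=
  alpha_of_classes (fun j =>
    grid_point am Gamma i.1 + grid_point (- (2 * Gamma)) r (i.2 j)).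

Lemma constraint_set_coarse_cover (R : realType) (k : nat) (Gamma am ap r : R) :
  0 < r ->
  class_cover (constraint_set Gamma am ap)
    (@coarse_center R k am ap r) (r + Gamma).
Proof.
move=> r0 alpha [aG a0]; have [i xi] := grid_cover r0 a0.
exists i => j; rewrite alpha_of_classesE /alpha_of.
apply: (le_trans (ler_distD (alpha ord0) _ _)).
by rewrite addrC lerD.
Qed.

Lemma constraint_set_fine_cover (R : realType) (k : nat) (Gamma am ap r : R) :
  0 < r -> 0 < Gamma ->
  class_cover (constraint_set Gamma am ap)
    (@fine_center R k Gamma am ap r) r.
Proof.
move=> r0 G0 alpha [aG a0]; have [i xi] := grid_cover G0 a0.
have /fin_all_exists[q qP] j : exists q : 'I_(grid_size (- (2 * Gamma)) (2 * Gamma) r),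
   `|alpha_of alpha j - grid_point am Gamma i - grid_point (- (2 * Gamma)) r q| <= r.
  apply: grid_cover => //; rewrite -ler_norml.
  apply: (le_trans (ler_distD (alpha ord0) _ _)).
  have := aG j; move: xi; rewrite /alpha_of; lra.
exists (i, [ffun j => q j]) => j.
by rewrite alpha_of_classesE/= ffunE opprD addrA.
Qed.

(** * Arithmetic of the constants and of the cover sizes *)

Lemma sqrtrD_le (R : realType) (a b : R) : 0 <= a -> 0 <= b ->
  Num.sqrt (a + b) <= Num.sqrt a + Num.sqrt b.
Proof.
move=> a0 b0; have sa := sqrtr_ge0 a; have sb := sqrtr_ge0 b.
rewrite -(@ler_pXn2r _ 2)// ?nnegrE ?sqrtr_ge0 ?addr_ge0//.
rewrite sqr_sqrtr ?addr_ge0// sqrrD !sqr_sqrtr//.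
by have := mulr_ge0 sa sb; lra.
Qed.

(** Here [N] is the size of the cover and [N'] the real number inside the logarithm of the excess
    term; the factor 2 allows for rounding. In units of [1 / sqrt n] the left side is at most
    [2 sqrt A + 2 sqrt B + 2], and [A >= ln 2 >= 1/2] lets [6 sqrt A] absorb the last 2. *)
Lemma confidence_radius_le (R : realType) (n N : nat) (N' delta : R) :
  (0 < n)%N -> (0 < N)%N -> 1 <= N' -> N%:R <= 2 * N' -> 0 < delta < 1 ->
  2 * Num.sqrt (ln (2 * N%:R / delta) / (2 * n%:R)) + 2 / Num.sqrt n%:R
    <= 8 * Num.sqrt (ln (2 / delta) / n%:R) + 4 / Num.sqrt n%:R * Num.sqrt (ln N').
Proof.
move=> n0 N0 N1 NN /andP[d0 d1].
have n0' : 0 < n%:R :> R by rewrite ltr0n.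
have N0' : 0 < N%:R :> R by rewrite ltr0n.
have Np : 0 < N' by lra.
have s0 : 0 < Num.sqrt (n%:R : R) by rewrite sqrtr_gt0.
set A := ln (2 / delta); set B := ln N'; set s : R := Num.sqrt n%:R in s0 *.
have B0 : 0 <= B by rewrite ln_ge0.
have ln2 : 1 / 2 <= ln 2 :> R.
  rewrite -ler_expR lnK ?posrE//.
  have := expR_ge1Dx (- (1 / 2) : R); rewrite expRN => h.
  by rewrite -[leRHS]invrK -[leLHS]invrK lef_pV2 ?posrE ?invr_gt0 ?expR_gt0//; lra.
have A2 : ln 2 <= A.
  by rewrite ler_ln ?posrE ?divr_gt0// ler_pdivlMr//; lra.
(* The rounding factor contributes [ln 2], which is at most [A] since [delta < 1]. *)
have lnN : ln (2 * N%:R / delta) <= 2 * A + B.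
  apply: (@le_trans _ _ (ln (2 * N' * (2 / delta)))).
    rewrite ler_ln ?posrE ?divr_gt0 ?mulr_gt0 ?invr_gt0//.
    by rewrite mulrA ler_pM2r ?invr_gt0//; lra.
  rewrite lnM ?posrE ?divr_gt0 ?mulr_gt0// lnM ?posrE// -/A -/B.
  by rewrite mulr_natl mulr2n -addrA (addrC B) addrA lerD2r lerD2r.
have sdiv x : 0 <= x -> Num.sqrt (x / n%:R) = Num.sqrt x / s.
  by move=> x0; rewrite sqrtrM// sqrtrV// ltW.
have A0 : 0 <= A by lra.
have tE : Num.sqrt (ln (2 * N%:R / delta) / (2 * n%:R)) <= (Num.sqrt A + Num.sqrt B) / s.
  apply: (@le_trans _ _ (Num.sqrt ((A + B) / n%:R))).
    apply: ler_wsqrtr; rewrite invfM mulrA ler_pM2r ?invr_gt0//.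
    by rewrite ler_pdivrMr//; lra.
  by rewrite sdiv ?addr_ge0// ler_pM2r ?invr_gt0// sqrtrD_le.
have sA : 1 / 3 <= Num.sqrt A.
  rewrite -(@ler_pXn2r _ 2)// ?nnegrE ?sqrtr_ge0//.
  by rewrite sqr_sqrtr//; lra.
have sB := sqrtr_ge0 B.
have H : 2 * (Num.sqrt A + Num.sqrt B) + 2 <= 8 * Num.sqrt A + 4 * Num.sqrt B by lra.
rewrite sdiv//.
have si : 0 < s^-1 by rewrite invr_gt0.
have := ler_wpM2r (ltW si) H.
by move: tE; set t := Num.sqrt (ln _ / _); lra.
Qed.

Lemma constraint_set_cover (R : realType) (k n : nat) (Gamma am ap Lf Lc : R) :
  0 < Gamma -> 2 * Gamma <= ap - am -> 0 < Lf -> 0 < Lc -> (0 < n)%N ->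
  exists (I : finType) (c : I -> 'I_k.+2 -> R) (N : R),
    [/\ class_cover (constraint_set Gamma am ap) c (1 / (2 * Num.sqrt n%:R * Lf * Lc)),
        (0 < #|I|)%N, #|I|%:R <= 2 * N, 1 <= N &
        excess_term k.+1 n Gamma am ap Lf Lc = 4 / Num.sqrt n%:R * Num.sqrt (ln N)].
Proof.
move=> G0 Ga Lf0 Lc0 n0; rewrite /excess_term.
have s0 : 0 < Num.sqrt (n%:R : R) by rewrite sqrtr_gt0 ltr0n.
set s : R := Num.sqrt (n%:R : R) in s0 *.
pose q : R := s * Lf * Lc.
have q0 : 0 < q by rewrite !mulr_gt0.
have qE (x : R) : x * s * Lf * Lc = x * q by rewrite /q !mulrA.
rewrite !qE.
have amap : am <= ap by lra.
case: ifPn => [Gq|]; [|rewrite -ltNge => Gq].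
  (* This mesh makes [1 + (ap - am) / (2 r)] equal to the argument of the logarithm. As
     [Gamma <= r], the covering radius [r + Gamma] is at most [2 r], within the allowed [4 r]. *)
  pose r : R := 1 / (8 * q).
  have r0 : 0 < r by rewrite divr_gt0// mulr_gt0.
  exists 'I_(grid_size am ap r), (@coarse_center R k am ap r).
  exists (1 + 4 * (ap - am) * q).
  have N1 : 1 <= 1 + 4 * (ap - am) * q by rewrite lerDl !mulr_ge0 ?subr_ge0// ltW.
  split=> //; last 2 first.
  - by rewrite card_ord.
  - rewrite card_ord (le_trans (grid_size_le r0 amap))//.
    have -> : (ap - am) / (2 * r) = 4 * (ap - am) * q.
      by rewrite /r; field; rewrite gt_eqF.
    by lra.
  move=> alpha /(constraint_set_coarse_cover r0)[i Hi]; exists i => j.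
  apply: (le_trans (Hi j)).
  have -> : 1 / (2 * q) = 4 * r by rewrite /r; field; rewrite gt_eqF.
  by rewrite -/r in Gq; lra.
pose r : R := 1 / (2 * q).
have r0 : 0 < r by rewrite divr_gt0// mulr_gt0.
exists ('I_(grid_size am ap Gamma) *
  {ffun 'I_k.+1 -> 'I_(grid_size (- (2 * Gamma)) (2 * Gamma) r)})%type.
exists (@fine_center R k Gamma am ap r).
pose u : R := 8 * Gamma * q; pose tau : R := (ap - am) / (2 * Gamma).
have u1 : 1 < u.
  by move: Gq; rewrite ltr_pdivrMr ?mulr_gt0// /u; lra.
have tau1 : 1 <= tau by rewrite ler_pdivlMr ?mulr_gt0// mul1r.
rewrite -/u -/tau.
have size0 : (grid_size am ap Gamma)%:R <= 2 * tau.
  by rewrite (le_trans (grid_size_le G0 amap))// -/tau; lra.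
(* The size is at most [1 + u / 2], which is below [u] only from [u = 2] on; for smaller [u] the
   grid is a single point and [1 < u] suffices. *)
have size1 : (grid_size (- (2 * Gamma)) (2 * Gamma) r)%:R <= u.
  rewrite /grid_size.
  have -> : (2 * Gamma - - (2 * Gamma)) / (2 * r) = u / 2.
    by rewrite /r /u; field; rewrite gt_eqF.
  have u20 : 0 <= u / 2 by lra.
  have [u2|u2] := ltP (u / 2) 1.
    have -> : Num.truncn (u / 2) = 0%N by apply/truncn0Pn; rewrite -ltNge.
    exact: ltW.
  have h : (Num.truncn (u / 2))%:R <= u / 2 by rewrite truncn_le.
  by rewrite -natr1; lra.
(* The grid has [k.+1] class factors; the stated exponent is one larger, which is harmless as
   [1 < u]. *)
exists (tau * u ^+ k.+2); split.
- exact: constraint_set_fine_cover.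
- by rewrite card_prod card_ffun !card_ord muln_gt0 expn_gt0.
- rewrite card_prod card_ffun !card_ord natrM natrX mulrA ler_pM// ?exprn_ge0//.
  apply: (@le_trans _ _ (u ^+ k.+1)); first by rewrite lerXn2r// ?nnegrE ltW// (lt_trans ltr01).
  by rewrite ler_eXn2l// ltW.
- by rewrite -[leLHS]mulr1 ler_pM// exprn_ege1// ltW.
- rewrite lnM ?posrE ?exprn_gt0 ?(lt_le_trans ltr01 tau1) ?(lt_trans ltr01 u1)//.
  by rewrite lnXn ?(lt_trans ltr01 u1)// (mulr_natl (ln u)).
Qed.

(** * Assembly of the cover, the deviation bound and the confidence level *)

Theorem theorem2
  (R : realType) (d : measure_display) (X : measurableType d) (k : nat)
  (flgt : X -> 'I_k.+1 -> R) (Lf : R)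
  (Lcalib : ('I_k.+1 -> R) -> ('I_k.+1 -> R) -> R) (Lc : R)
  (Gamma am ap : R) (n : nat) (delta : R)
  (dO : measure_display) (Omega : measurableType dO) (P : probability Omega R)
  (D : probability (X * 'I_k.+1)%type R) (Z : 'I_n -> Omega -> X * 'I_k.+1)
  (astar : Omega -> 'I_k.+2 -> R) :
  (forall j, measurable_fun setT (fun x => flgt x j)) ->
  0 < Lf -> (forall x, l2norm (flgt x) <= Lf) ->
  (forall y p, 0 <= Lcalib y p <= 1) ->
  0 < Lc ->
  (forall y p q, `|Lcalib y p - Lcalib y q| <= Lc * l2norm (fun j => p j - q j)) ->
  0 < Gamma -> am <= ap -> 2 * Gamma <= ap - am ->
  (0 < n)%N -> 0 < delta ->
  iid_sample P D Z ->
  (forall w, constraint_set Gamma am ap (astar w) /\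
     forall alpha, constraint_set Gamma am ap alpha ->
       emp_loss flgt Lcalib (fun i => Z i w) (astar w)
         <= emp_loss flgt Lcalib (fun i => Z i w) alpha) ->
  exists G : set Omega, measurable G /\ ((1 - delta)%:E <= P G)%E /\
    forall w, G w ->
      pop_loss flgt Lcalib D (astar w)
        <= inf [set pop_loss flgt Lcalib D alpha | alpha in constraint_set Gamma am ap]
           + 8 * Num.sqrt (ln (2 / delta) / n%:R)
           + excess_term k.+1 n Gamma am ap Lf Lc.
Proof.
move=> mf Lf0 fL L01 Lc0 LL G0 amap Ga n0 d0 iidZ opt.
(* For [delta >= 1] the empty event will do. *)
have [d1|d1] := leP 1 delta.
  by exists set0; split=> //; split=> //; rewrite measure0 lee_fin subr_le0.
have n0' : 0 < n%:R :> R by rewrite ltr0n.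
have s0 : 0 < Num.sqrt (n%:R : R) by rewrite sqrtr_gt0.
have [I [c [N [cov I0 IN N1 ->]]]] := @constraint_set_cover R k n _ _ _ _ _ G0 Ga Lf0 Lc0 n0.
have I0' : 0 < #|I|%:R :> R by rewrite ltr0n.
have rad := confidence_radius_le n0 I0 N1 IN (introT andP (conj d0 d1)).
set t := Num.sqrt (ln (2 * #|I|%:R / delta) / (2 * n%:R)) in rad.
have loss_cov a : constraint_set Gamma am ap a -> exists i, forall z,
    `|cw_loss flgt Lcalib a z - cw_loss flgt Lcalib (c i) z| <= 1 / (2 * Num.sqrt n%:R).
  move=> /cov[i ai]; exists i => z.
  apply: (le_trans (cw_loss_lipschitz z fL (ltW Lc0) LL ai)).
  rewrite le_eqVlt; apply/orP; left; apply/eqP.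
  by field; rewrite !gt_eqF.
have ml a := measurable_cw_loss a mf (ltW Lc0) LL.
have [G [mG PG HG]] := erm_finite_cover iidZ n0 ml (fun a z => L01 _ _) loss_cov
  (sqrtr_ge0 _ : 0 <= t) opt.
exists G; split=> //; split.
  rewrite -[P G]fineK ?fin_num_measure// lee_fin (le_trans _ PG)// lerD2l lerN2.
  (* Nonnegativity lets the square undo the root in [t]; the failure probability
     [2 #|I| exp (- 2 n t^2)] is then exactly [delta]. *)
  have lnN : 0 <= ln (2 * #|I|%:R / delta).
    rewrite ln_ge0// ler_pdivlMr// mul1r.
    by have : 1 <= #|I|%:R :> R; [rewrite ler1n|lra].
  rewrite /t sqr_sqrtr ?divr_ge0 ?mulr_ge0//.
  rewrite (mulrC (2 * n%:R)) divfK ?gt_eqF ?mulr_gt0//.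
  rewrite expRN lnK ?posrE ?divr_gt0 ?mulr_gt0//.
  rewrite le_eqVlt; apply/orP; left; apply/eqP.
  by field; rewrite !gt_eqF.
(* The bound holds against every competitor on the same event, so it passes to the infimum;
   [astar w] shows that the set is nonempty. *)
move=> w Gw; rewrite -addrA -lerBlDr; apply: lb_le_inf.
  by exists (pop_loss flgt Lcalib D (astar w)); exists (astar w) => //; have [] := opt w.
move=> _ [a Fa <-]; rewrite lerBlDr.
apply: (le_trans (HG w Gw a Fa)); rewrite -addrA lerD2l.
apply: le_trans rad; rewrite lerD2l.
by rewrite le_eqVlt; apply/orP; left; apply/eqP; field; rewrite gt_eqF.
Qed.
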